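(* Let $\langle\mathfrak{B},\mathsf{C}\rangle$ be a complete Boolean contact algebra satisfying (C4$^c$), and let $m\colon B\to B$ be the operator defined by letting $m(x)$ be the unique $y\in B$ such that $\mathsf{C}(x)=\mathsf{O}(y)$. Then $m$ is a completely additive modal possibility operator, i.e. $m(\mathbf{0})=\mathbf{0}$, $m(x+y)=m(x)+m(y)$ for all $x,y\in B$, and $m\left(\bigvee J\right)=\bigvee_{x\in J}m(x)$ for every $J\subseteq B$; moreover, for all $x,y\in B$: (1) $x\ll m(x)$, and so $x\leq m(x)$, i.e. $x+m(x)=m(x)$; (2) $m(x)\leq -y$ if and only if $m(y)\leq -x$; and this condition (for all $x,y$) is equivalent to: $m(-m(-x))\leq x$ for all $x$.
   Context: A Boolean contact algebra is a pair $\langle\mathfrak{B},\mathsf{C}\rangle$ where $\mathfrak{B}=\langle B,\cdot,+,-,\mathbf{0},\mathbf{1}\rangle$ is a Boolean algebra and $\mathsf{C}\subseteq B\times B$ satisfies, for all $x,y,z\in B$: (C0) not $\mathbf{0}\mathrel{\mathsf{C}}x$; (C1) if $x\le y$ and $x\ne\mathbf{0}$, then $x\mathrel{\mathsf{C}}y$; (C2) if $x\mathrel{\mathsf{C}}y$, then $y\mathrel{\mathsf{C}}x$; (C3) if $x\le y$ and $z\mathrel{\mathsf{C}}x$, then $z\mathrel{\mathsf{C}}y$; (C4) if $x\mathrel{\mathsf{C}}(y+z)$, then $x\mathrel{\mathsf{C}}y$ or $x\mathrel{\mathsf{C}}z$. It is complete if $\mathfrak{B}$ is a complete Boolean algebra.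 (C4$^c$): for every $x\in B$ and every $J\subseteq B$, if $x\mathrel{\mathsf{C}}\bigvee J$, then there is $y\in J$ with $x\mathrel{\mathsf{C}}y$. Notation: $\mathsf{C}(x)=\{y\in B\mid y\mathrel{\mathsf{C}}x\}$; $\mathsf{O}(x)=\{y\in B\mid y\cdot x\neq\mathbf{0}\}$; $x\ll y$ iff not $x\mathrel{\mathsf{C}}(-y)$. In a complete Boolean contact algebra satisfying (C4$^c$), for every $x$ there is exactly one $y$ with $\mathsf{C}(x)=\mathsf{O}(y)$, so $m$ is well defined. *)

(* Defs.v *)
From mathcomp Require Import all_boot all_order.
From mathcomp Require Import boolp classical_sets.

Set Implicit Arguments.
Unset Strict Implicit.
Unset Printing Implicit Defensive.

Import Order.Theory.
Local Open Scope classical_set_scope.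
Local Open Scope order_scope.

(* Boolean algebras are the types of structure [ctbDistrLatticeType]: [\bot],
   [\top], [x `&` y], [x `|` y] and [~` x] stand for 0, 1, x . y, x + y and -x.
   Subsets of the carrier are arbitrary sets in the sense of [classical_sets]. *)

Definition complete_lattice (d : Order.disp_t) (B : porderType d) : Prop :=
  forall J : set B, supremums J !=set0.

(* [supremum] returns its first argument on [set0], hence the [\bot]. *)
Definition bigjoin (d : Order.disp_t) (B : ctbDistrLatticeType d)
  (J : set B) : B := supremum \bot J.

Record contact_relation (d : Order.disp_t) (B : ctbDistrLatticeType d)
    (C : B -> B -> Prop) : Prop := ContactRelation {
  contact0 : forall x, ~ C \bot x;
  contact_le : forall x y, x <= y -> x <> \bot -> C x y;
  contact_sym : forall x y, C x y -> C y x;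
  contact_mono : forall x y z, x <= y -> C z x -> C z y;
  contactU : forall x y z, C x (y `|` z) -> C x y \/ C x z
}.

Definition contact_bigjoin (d : Order.disp_t)
    (B : ctbDistrLatticeType d) (C : B -> B -> Prop) : Prop :=
  forall (x : B) (J : set B), C x (bigjoin J) -> exists2 y, J y & C x y.

Definition contact_set (d : Order.disp_t) (B : ctbDistrLatticeType d)
  (C : B -> B -> Prop) (x : B) : set B := [set y | C y x].

Definition overlap_set (d : Order.disp_t) (B : ctbDistrLatticeType d)
  (x : B) : set B := [set y | y `&` x <> \bot].

Definition well_inside (d : Order.disp_t) (B : ctbDistrLatticeType d)
  (C : B -> B -> Prop) (x y : B) : Prop := ~ C x (~` y).

(* The y such that C(x) = O(y); see [contact_modality_exists_unique] for
   existence and uniqueness. The default value [\bot] is never used under its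
   hypotheses. *)
Definition contact_modality (d : Order.disp_t) (B : ctbDistrLatticeType d)
  (C : B -> B -> Prop) (x : B) : B :=
  xget \bot [set y | contact_set C x = overlap_set y].

Lemma bigjoin_supremums (d : Order.disp_t) (B : ctbDistrLatticeType d) :
  complete_lattice B -> forall J : set B, supremums J (bigjoin J).
Proof.
move=> cB J; rewrite /bigjoin /supremum; case: ifPn => [/eqP ->|_].
  by split=> [x []|x _]; exact: le0x.
by apply: xgetPex; exact: cB.
Qed.

Lemma overlap_set_inj (d : Order.disp_t) (B : ctbDistrLatticeType d) :
  injective (@overlap_set d B).
Proof.
have le_of (y z : B) : overlap_set y = overlap_set z -> y <= z.
  move=> /(congr1 (fun A : set B => A (~` z))) eO.
  have : ~ overlap_set y (~` z) by rewrite eO /overlap_set /= meetCx.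
  by rewrite /overlap_set /= => /contrapT yz; rewrite -diff_eq0 diffE meetC yz eqxx.
by move=> y z e; apply/le_anti; rewrite !le_of.
Qed.

Lemma contact_modality_exists_unique (d : Order.disp_t)
    (B : ctbDistrLatticeType d) (C : B -> B -> Prop) :
  complete_lattice B -> contact_relation C ->
  contact_bigjoin C ->
  forall x, exists! y, contact_set C x = overlap_set y.
Proof.
move=> cB cC dC x; pose s := bigjoin [set z | ~ C z x].
have [ubs _] := bigjoin_supremums cB [set z | ~ C z x].
have ex : contact_set C x = overlap_set (~` s).
  rewrite predeqE => z; rewrite /contact_set /overlap_set /= -diffE.
  split=> [Czx /eqP|ns]; last first.
    by apply: contrapT => nC; apply: ns; apply/eqP; rewrite diff_eq0; exact: ubs.
  rewrite diff_eq0 => zs.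
  have /dC[y /= nC Cxy] : C x s by exact: contact_mono cC _ _ _ zs (contact_sym cC Czx).
  exact/nC/(contact_sym cC).
by exists (~` s); split=> // y; rewrite ex; exact: overlap_set_inj.
Qed.

Lemma contact_modalityE (d : Order.disp_t) (B : ctbDistrLatticeType d)
    (C : B -> B -> Prop) :
  complete_lattice B -> contact_relation C ->
  contact_bigjoin C ->
  forall x, contact_set C x = overlap_set (contact_modality C x).
Proof.
move=> cB cC dC x.
have [y [ey _]] := contact_modality_exists_unique cB cC dC x.
by rewrite /contact_modality; apply: (@xgetI _ _ [set y | _ = overlap_set y] y).
Qed.

(* Main.v *)
Require Import Defs.
From mathcomp Require Import all_boot all_order.
From mathcomp Require Import boolp classical_sets.

Import Order.Theory.
Local Open Scope classical_set_scope.
Local Open Scope order_scope.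

(** By definition of [m], [y `&` m x <> \bot] iff [C y x], that is,
    [m x <= ~` y] iff [C y x] fails. As contact is symmetric, so is this
    condition in [x] and [y]. Complementing [y] turns the symmetry into a Galois
    connection: [m] is left adjoint to [fun z => ~` m (~` z)], and hence
    preserves all existing joins. *)

Lemma bigjoin_leP (d : Order.disp_t) (B : ctbDistrLatticeType d)
    (Bcomplete : complete_lattice B) (J : set B) (z : B) :
  bigjoin J <= z <-> ubound J z.
Proof.
have [ubJ lubJ] := bigjoin_supremums Bcomplete J.
split=> [Jz x Jx|]; last exact: lubJ.
exact: le_trans (ubJ x Jx) Jz.
Qed.

(** Taking [z] to be [a] and then [b] gives both inequalities. Equalities between joins thus reduce
    to comparing upper bounds. *)
Lemma le_eqP (d : Order.disp_t) (T : porderType d) (a b : T) :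
  (forall z, a <= z <-> b <= z) -> a = b.
Proof.
by move=> ab; apply/le_anti/andP; split; apply/ab.
Qed.

Section LeftAdjoint.
Context (d : Order.disp_t) (B : ctbDistrLatticeType d) (f g : B -> B).
Context (fgP : forall x z : B, f x <= z <-> x <= g z).

Lemma left_adjoint0 : f \bot = \bot.
Proof. by apply/eqP; rewrite -lex0; apply/fgP; exact: le0x. Qed.

Lemma left_adjointU (x y : B) : f (x `|` y) = f x `|` f y.
Proof.
apply: le_eqP => z; rewrite fgP !leUx.
by split=> /andP[xz yz]; apply/andP; split; apply/fgP.
Qed.

Lemma left_adjoint_bigjoin (Bcomplete : complete_lattice B) (J : set B) :
  f (bigjoin J) = bigjoin (f @` J).
Proof.
apply: le_eqP => z; rewrite fgP !bigjoin_leP //.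
(* By adjunction, [g z] bounds [J] exactly when [z] bounds the image of [J]. *)
split=> [ubJ _ [x Jx <-]|ubJ x Jx]; first by apply/fgP; exact: ubJ.
by apply/fgP; apply: ubJ; exists x.
Qed.

End LeftAdjoint.

Section SelfConjugate.
Context (d : Order.disp_t) (B : ctbDistrLatticeType d) (f : B -> B).

Lemma self_conjugate_adjoint :
  (forall x y : B, f x <= ~` y <-> f y <= ~` x) ->
  forall x z : B, f x <= z <-> x <= ~` f (~` z).
Proof. by move=> fC x z; rewrite -{1}[z]complK fC lexC. Qed.

(** The inequality on the right is the counit of the adjunction between [f] and [fun z => ~] f
    (~[z)]; for monotone [f] it gives conjugacy back. *)
Lemma self_conjugate_iff (f_homo : {homo f : x y / x <= y}) :
  (forall x y : B, f x <= ~` y <-> f y <= ~` x) <->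
  (forall x : B, f (~` f (~` x)) <= x).
Proof.
split=> [fC x|fB]; first exact/(self_conjugate_adjoint fC).
suff fC x y : f x <= ~` y -> f y <= ~` x by move=> x y; split; exact: fC.
(* Applying [f] to [y <= ~] f x[leaves]f (~[f x) <= ~] x[, the counit at]~[x]. *)
rewrite lexC => /f_homo /le_trans; apply.
by have := fB (~` x); rewrite complK.
Qed.

End SelfConjugate.

Section ContactModality.
Context (d : Order.disp_t) (B : ctbDistrLatticeType d) (C : B -> B -> Prop).
Context (Bcomplete : complete_lattice B) (Ccontact : contact_relation C)
  (C4c : contact_bigjoin C).
Local Notation m := (contact_modality C).

Lemma contact_modality_leP (x y : B) : m x <= ~` y <-> ~ C y x.
Proof.
have /(congr1 (@^~ y)) := contact_modalityE Bcomplete Ccontact C4c x.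
rewrite /contact_set /overlap_set /= => ->.
rewrite notK lexC -diff_eq0 diffE complK.
by split=> /eqP.
Qed.

Lemma contact_modality_conjugate (x y : B) : m x <= ~` y <-> m y <= ~` x.
Proof.
rewrite !contact_modality_leP.
by split=> nC /(contact_sym Ccontact).
Qed.

Lemma well_inside_contact_modality (x : B) : well_inside C x (m x).
Proof.
by apply/contact_modality_leP/contact_modality_conjugate; rewrite complK.
Qed.

End ContactModality.

Lemma well_inside_le (d : Order.disp_t) (B : ctbDistrLatticeType d)
    (C : B -> B -> Prop) (Ccontact : contact_relation C) (x y : B) :
  well_inside C x y -> x <= y.
Proof.
(* A nonzero [x]&[~] y[lies below both]x[and]~[y], and so would put them in contact. *)
move=> xy; rewrite -diff_eq0 diffE; apply/eqP; apply: contrapT => xNy; apply: xy.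
apply: (contact_sym Ccontact); apply: (contact_mono Ccontact) (leIl x (~` y)) _.
apply: (contact_sym Ccontact); exact: (contact_le Ccontact) (leIr (~` y) x) xNy.
Qed.

Theorem lemma6p4 (d : Order.disp_t) (B : ctbDistrLatticeType d)
    (C : B -> B -> Prop)
    (Bcomplete : complete_lattice B)
    (Ccontact : contact_relation C)
    (C4c : contact_bigjoin C) :
  let m : B -> B := contact_modality C in
  [/\ m \bot = \bot,
      forall x y : B, m (x `|` y) = m x `|` m y
    & forall J : set B, m (bigjoin J) = bigjoin (image J m)] /\
  (forall x : B,
     [/\ well_inside C x (m x), x <= m x & x `|` m x = m x]) /\
  (forall x y : B, m x <= ~` y <-> m y <= ~` x) /\
  ((forall x y : B, m x <= ~` y <-> m y <= ~` x) <->
   (forall x : B, m (~` m (~` x)) <= x)).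
Proof.
move=> m.
have mC : forall x y, m x <= ~` y <-> m y <= ~` x.
  exact: contact_modality_conjugate.
have mP := self_conjugate_adjoint _ _ _ mC.
have mU := left_adjointU _ _ _ _ mP.
split; [split=> // [|J]|split=> [x|]].
- exact: left_adjoint0 mP.
- exact: left_adjoint_bigjoin mP _ _.
- have wi : well_inside C x (m x) by exact: well_inside_contact_modality.
  have xm : x <= m x by exact: well_inside_le wi.
  by split=> //; apply/join_idPr.
split=> //; apply: self_conjugate_iff => x y /join_idPr xy.
(* Additivity makes [m] monotone: [x]|[y = y] gives [m y = m x]|[m y]. *)
by rewrite -xy mU leUl.
Qed.
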